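(* Let $G$ and $H$ be two connected graphs of orders $n$ and $m\neq 1$, respectively, where $\gamma_{sp}(H)<m-1$ or $H=K_m$. Then $n(\gamma_{sp}(H)+1)\leq\gamma_{sp}(G\star H)$.
   Context: All graphs are finite, simple, undirected. $K_m$ is the complete graph on $m$ vertices. For $S\subseteq V(G)$, $\overline{S}=V(G)\setminus S$ and $N(v)$ denotes the open neighbourhood of $v$. A set $S$ is a super dominating set of $G$ if every vertex of $\overline{S}$ has a neighbour in $S$ and for every $u\in\overline{S}$ there is $v\in S$ with $N(v)\cap\overline{S}=\{u\}$. The super domination number $\gamma_{sp}(G)$ is the minimum cardinality of a super dominating set of $G$. The neighbourhood corona product $G\star H$ is the graph obtained by taking one copy of $G$ and $|V(G)|$ disjoint copies of $H$, one copy $H_w$ for each vertex $w$ of $G$, and joining every neighbour (in $G$) of $w$ to every vertex of $H_w$, for each $w\in V(G)$. *)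

(* Defs.v *)
From mathcomp Require Import all_boot.

Set Implicit Arguments.
Unset Strict Implicit.
Unset Printing Implicit Defensive.

Record sgraph := SGraph {
  vertex :> finType;
  adj : rel vertex;
  adj_sym : symmetric adj;
  adj_irrefl : irreflexive adj
}.

(* The graph without vertices is not connected. *)
Definition connected (G : sgraph) : Prop :=
  0 < #|G| /\ forall x y : G, connect (@adj G) x y.

Definition nbhd (G : sgraph) (v : G) : {set G} := [set u | adj v u].

Definition dominating (G : sgraph) (S : {set G}) : bool :=
  [forall u in ~: S, exists v in S, adj u v].

Definition super_dominating (G : sgraph) (S : {set G}) : bool :=
  dominating S &&
  [forall u in ~: S, exists v in S, nbhd v :&: ~: S == [set u]].

(* The minimum is over a nonempty family: it contains the whole vertex set,
   see [super_dominatingT]. *)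
Definition gamma_sp (G : sgraph) : nat :=
  #|[arg min_(S < [set: G] | super_dominating S) #|S|]|.

Definition isomorphic (G H : sgraph) : Prop :=
  exists2 f : G -> H, bijective f & forall x y, adj (f x) (f y) = adj x y.

Definition complete_adj (m : nat) : rel 'I_m := fun i j => i != j.

Lemma complete_adj_sym m : symmetric (@complete_adj m).
Proof. by move=> i j; rewrite /complete_adj eq_sym. Qed.

Lemma complete_adj_irrefl m : irreflexive (@complete_adj m).
Proof. by move=> i; rewrite /complete_adj eqxx. Qed.

Definition complete (m : nat) : sgraph :=
  SGraph (@complete_adj_sym m) (@complete_adj_irrefl m).

(* [inl v] is the vertex v of G; [inr (w, h)] is the vertex h of the copy of H
   attached to the vertex w of G. *)
Definition ncorona_adj (G H : sgraph) : rel (G + G * H)%type := fun x y =>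
  match x, y with
  | inl v, inl w => adj v w
  | inl v, inr (w, _) => adj w v
  | inr (w, _), inl v => adj w v
  | inr (w, h), inr (w', h') => (w == w') && adj h h'
  end.

Lemma ncorona_adj_sym G H : symmetric (@ncorona_adj G H).
Proof.
move=> [v|[w h]] [v'|[w' h']] //=; first by rewrite adj_sym.
by rewrite eq_sym adj_sym.
Qed.

Lemma ncorona_adj_irrefl G H : irreflexive (@ncorona_adj G H).
Proof. by move=> [v|[w h]] /=; rewrite adj_irrefl ?andbF. Qed.

Definition ncorona (G H : sgraph) : sgraph :=
  SGraph (@ncorona_adj_sym G H) (@ncorona_adj_irrefl G H).

Lemma super_dominatingT (G : sgraph) : super_dominating [set: G].
Proof.
by apply/andP; split; apply/forall_inP => u; rewrite setCT inE.
Qed.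

Lemma gamma_spP (G : sgraph) :
  (exists2 S : {set G}, super_dominating S & #|S| = gamma_sp G) /\
  (forall S : {set G}, super_dominating S -> gamma_sp G <= #|S|).
Proof.
rewrite /gamma_sp; case: arg_minnP => [|S sdS minS].
  exact: super_dominatingT.
by split=> //; exists S.
Qed.

(* Main.v *)
(* Let C be the complement of a super dominating set S of G * H, let A be its
   trace on G and C_w its trace on H_w, and put k = m - gamma_sp(H) >= 1.
   Since #|C| = #|A| + \sum_w #|C_w|, the claim is that this sum is at most n k.
   If the private neighbours of all elements of C_w lie in H_w, then C_w is the
   complement of a super dominating set of H; if one of them lies in G, then
   #|C_w| = 1. So #|C_w| <= k always, and it remains to charge the elements a of
   A injectively to vertices w with #|C_w| < k. If C_a is empty, take w = a. If
   not, the private neighbour of a lies in some H_w with w adjacent to a and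
   w \notin A, and a is the only neighbour of w in A. No vertex of H_w is then
   private to an element of C_w, so #|C_w| <= 1, and C_w is even empty when H is
   complete. *)

Require Import Defs.
From mathcomp Require Import all_boot.

Set Implicit Arguments.
Unset Strict Implicit.
Unset Printing Implicit Defensive.

Definition private (K : sgraph) (S : {set K}) (v u : K) : Prop :=
  [/\ v \in S, u \notin S, adj v u & forall y, y \notin S -> adj v y -> y = u].

(** The domination clause comes for free: a private neighbour of [u] lies in [S] and is adjacent to
    [u]. *)
Lemma super_dominatingP (K : sgraph) (S : {set K}) :
  super_dominating S <-> forall u, u \notin S -> exists v, private S v u.
Proof.
split=> [/andP[_ /forall_inP sdS] u uS|priv].
  have uC : u \in ~: S by rewrite inE.
  have /exists_inP[v vS /eqP Nv] := sdS u uC; exists v; split=> //.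
    have /setIP[] : u \in nbhd v :&: ~: S by rewrite Nv set11.
    by rewrite inE.
  by move=> y yS vy; apply/set1P; rewrite -Nv !inE vy yS.
apply/andP; split; apply/forall_inP => u; rewrite inE => uS;
  have [v [vS _ vu uniqv]] := priv u uS.
  by apply/exists_inP; exists v; rewrite // adj_sym.
apply/exists_inP; exists v => //; apply/eqP/setP=> y; rewrite !inE.
apply/andP/eqP => [[vy yS]|->]; last by split.
exact: uniqv.
Qed.

Lemma gamma_sp_le_card (K : sgraph) : gamma_sp K <= #|K|.
Proof. by rewrite -cardsT; apply/(gamma_spP K).2/super_dominatingT. Qed.

Lemma gamma_sp_complete (K : sgraph) :
  1 < #|K| -> (forall x y : K, adj x y = (x != y)) -> gamma_sp K < #|K|.
Proof.
move=> K_gt1 adjE; have [x [y [_ _ xy]]] := card_gt1P K_gt1.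
have sdx : super_dominating (~: [set x]).
  apply/super_dominatingP => u; rewrite !inE negbK => /eqP->.
  exists y; rewrite eq_sym in xy; split; rewrite ?adjE ?inE ?negbK //.
  by move=> z; rewrite !inE negbK => /eqP.
apply: leq_ltn_trans ((gamma_spP K).2 _ sdx) _.
by rewrite cardsCs setCK cards1 ltn_subrL (ltnW K_gt1).
Qed.

Lemma isomorphic_complete (K : sgraph) (m : nat) :
  isomorphic K (complete m) -> forall x y : K, adj x y = (x != y).
Proof. by case=> f /bij_inj injf adjf x y; rewrite -adjf /= /complete_adj inj_eq. Qed.

Section NeighbourhoodCorona.

Variables (G H : sgraph) (S : {set ncorona G H}).
Hypothesis sdS : super_dominating S.

Let priv := (super_dominatingP S).1 sdS.
Let k := #|H| - gamma_sp H.

Let base (v : G) : ncorona G H := inl v.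
Let copy (w : G) (h : H) : ncorona G H := inr (w, h).
Let A := [set a | base a \notin S].
Let C w := [set h | copy w h \notin S].

Lemma card_compl_ncorona : #|~: S| = #|A| + \sum_w #|C w|.
Proof.
rewrite -sum1_card big_sumType /=; congr (_ + _).
  by rewrite -sum1_card; apply: eq_bigl => a; rewrite !inE.
under [RHS]eq_bigr => w _ do rewrite -sum1_card.
rewrite pair_big_dep /=.
by apply: eq_bigl => -[w h]; rewrite !inE.
Qed.

(** A vertex of [G] adjacent to one vertex of a copy of [H] is adjacent to that whole copy. *)
Lemma base_private_copy v w u : private S (base v) (copy w u) -> C w = [set u].
Proof.
move=> [_ uS vw uniqv]; apply/setP=> h; rewrite !inE.
by apply/idP/eqP => [hS|-> //]; have [] := uniqv (copy w h) hS vw.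
Qed.

Lemma copy_private w u :
  u \in C w -> #|C w| != 1 -> exists h, private S (copy w h) (copy w u).
Proof.
rewrite inE => /priv[[v|[w' h]] pvu] cardC.
  by rewrite (base_private_copy pvu) cards1 in cardC.
exists h; have [_ _ /= /andP[/eqP eqw _] _] := pvu.
by rewrite /copy -{1}eqw.
Qed.

Lemma card_copy_le w : gamma_sp H < #|H| -> #|C w| <= k.
Proof.
move=> ltH; have [cardC|cardC] := eqVneq #|C w| 1; first by rewrite cardC subn_gt0.
have sdC : super_dominating (~: C w).
  apply/super_dominatingP => u; rewrite inE negbK => uC.
  have [h [hS uS /= /andP[_ hu] uniqh]] := copy_private uC cardC.
  exists h; split=> //; rewrite ?inE ?negbK //.
  move=> y; rewrite !inE negbK => yS hy.
  by have := uniqh (copy w y) yS; rewrite /= eqxx => /(_ hy)[].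
rewrite leq_subRL ?gamma_sp_le_card // addnC -(cardsC (C w)) leq_add2l.
exact: (gamma_spP H).2.
Qed.

(* A vertex of A adjacent to w is adjacent to all of H_w. *)
Lemma card_copy_le1 w a : a \in A -> adj w a -> #|C w| <= 1.
Proof.
rewrite inE => aS wa; have [->//|cardC] := eqVneq #|C w| 1.
have [->|[u uC]] := set_0Vmem (C w); first by rewrite cards0.
have [h [_ _ _ uniqh]] := copy_private uC cardC.
by have := uniqh (base a) aS wa.
Qed.

(** A private neighbour of a vertex of [C a] is not in [G], where it would also see [a]. So it lies
    in the copy at [a], and it sees every neighbour [b] of [a] in [G]. *)
Lemma copy_base_isolated a b : a \in A -> C a != set0 -> b \in A -> ~~ adj a b.
Proof.
rewrite !inE => aS /set0Pn[u]; rewrite inE => /priv[[v|[w h]]].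
  move=> [_ _ /= av uniqv] _; have := uniqv (base a) aS.
  by rewrite /= adj_sym => /(_ av).
move=> [_ _ /= /andP[/eqP-> _] uniqh] bS; apply/negP=> ab.
by have := uniqh (base b) bS ab.
Qed.

Hypothesis gammaH : gamma_sp H < #|H|.
Hypothesis hypH : 1 < k \/ forall x y : H, adj x y = (x != y).

Lemma charge a : a \in A -> exists2 w, #|C w| < k &
  w = a \/ [/\ w \notin A, adj w a & forall b, b \in A -> adj w b -> b = a].
Proof.
move=> aA; have [Ca|Ca] := eqVneq (C a) set0.
  by exists a; [rewrite Ca cards0 subn_gt0|left].
have := aA; rewrite inE => /priv[[v|[w h]] [vS _ /= va uniqv]].
  (* A private neighbour [v] of [a] in [G] would also see the nonempty [C a]. *)
  have /set0Pn[u] := Ca; rewrite inE => uS.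
  by have := uniqv (copy a u) uS; rewrite /= adj_sym => /(_ va).
exists w; last first.
  right; split=> // [|b]; first last.
    by rewrite inE => bS wb; have [] := uniqv (base b) bS wb.
  by apply: contraL va => wA; rewrite adj_sym copy_base_isolated.
case: hypH => [|adjE]; first exact/leq_ltn_trans/(card_copy_le1 aA).
(* As [h] is in [S], any [u] in [C w] differs from [h], hence is a second neighbour of [h] outside
   [S]. *)
suff ->: C w = set0 by rewrite cards0 subn_gt0.
apply/setP=> u; rewrite !inE; apply/negbTE/negP=> uS.
have := uniqv (copy w u) uS; rewrite /= eqxx adjE.
by case: eqP => [hu|_ /(_ isT)//]; rewrite -/(copy w h) hu (negbTE uS) in vS.
Qed.

Lemma card_base_le : #|A| <= #|[set w | #|C w| < k]|.
Proof.
have /fin_all_exists[f fP] : forall a, exists w, a \in A -> #|C w| < k /\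
    (w = a \/ [/\ w \notin A, adj w a & forall b, b \in A -> adj w b -> b = a]).
  move=> a; have [/charge[w Cw cw]|_] := boolP (a \in A); first by exists w.
  by exists a.
have injf : {in A &, injective f}.
  move=> a b aA bA; have [_ ca] := fP a aA; have [_ cb] := fP b bA.
  (* Charges of different kinds cannot collide: one lies in [A], the other outside. *)
  case: ca => [->|[faA _ fa]]; case: cb => [->//|[fbA fb _]] fab.
  - by rewrite -fab aA in fbA.
  - by rewrite fab bA in faA.
  - by apply/esym/fa; rewrite // fab.
rewrite -(card_in_imset injf); apply/subset_leq_card/subsetP=> _ /imsetP[a aA ->].
by rewrite inE; have [] := fP a aA.
Qed.

Lemma card_compl_ncorona_le : #|~: S| <= #|G| * k.
Proof.
rewrite card_compl_ncorona; apply: leq_trans (leq_add card_base_le (leqnn _)) _.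
(* Each [w] now contributes [#|C w|], plus 1 exactly when [#|C w| < k]; so at most [k]. *)
rewrite -sum1_card big_mkcond -big_split /= -sum_nat_const.
apply: leq_sum => w _; rewrite inE; case: ltnP => [//|_].
exact: card_copy_le.
Qed.

End NeighbourhoodCorona.

Theorem theorem3p3 (G H : sgraph) (n m : nat)
    (connG : connected G) (connH : connected H)
    (cardG : #|G| = n) (cardH : #|H| = m) (m_neq1 : m <> 1)
    (hypH : gamma_sp H < m - 1 \/ isomorphic H (complete m)) :
  n * (gamma_sp H + 1) <= gamma_sp (ncorona G H).
Proof.
have H_gt1 : 1 < #|H| by rewrite ltn_neqAle eq_sym cardH (introN eqP m_neq1) -cardH connH.1.
have [gammaH hypH'] : gamma_sp H < #|H| /\
    (1 < #|H| - gamma_sp H \/ forall x y : H, adj x y = (x != y)).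
  case: hypH => [ltm|/isomorphic_complete adjE].
    rewrite -cardH ltn_subRL in ltm.
    by split; [apply: leq_ltn_trans ltm; rewrite leq_addl|left; rewrite ltn_subRL addnC].
  by split; [exact: gamma_sp_complete|right].
have [[S sdS <-] _] := gamma_spP (ncorona G H).
(* Adding [#|~: S|] to both sides turns the right one into the order [n + n * #|H|]. *)
rewrite -(leq_add2r #|~: S|) cardsC card_sum card_prod cardG.
have leC := card_compl_ncorona_le sdS gammaH hypH'.
apply: leq_trans (leq_add (leqnn _) leC) _.
by rewrite cardG -mulnDr addnAC subnKC ?(ltnW gammaH) // addn1 mulnS.
Qed.
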